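(* For every integer $k\ge2$ there exists an oracle $\mathcal{A}$ such that $\mathrm{UP}_{\le k}^{\mathcal{A}}\not\subseteq \mathrm{coNP}^{\mathrm{U}\Sigma^{p,\mathcal{A}}_{k-1}}$.
   Context: Alphabet $\{0,1\}$. $\mathrm{UP}_{\le k}^{A}$ is the class of sets accepted by a nondeterministic polynomial-time oracle Turing machine with oracle $A$ having at most $k$ accepting paths on every input. A $\Sigma_j(A)$-system $[A;N_1,\dots,N_j]$ consists of $A$ and nondeterministic polynomial-time oracle Turing machines; its language is $L[A;N_1]=L(N_1^A)$ and $L[A;N_1,\dots,N_j]=L(N_1^{L[A;N_2,\dots,N_j]})$; its computation on $x$ is that of $N_1$ on $x$ with oracle $A$ ($j=1$) or $L[A;N_2,\dots,N_j]$ ($j>1$); it is unambiguous if for every $1\le i\le j$ and every input $y$, $[A;N_i,\dots,N_j](y)$ has at most one accepting path. $\mathrm{U}\Sigma^{p,A}_j$ ($j\ge1$) is the class of languages of unambiguous $\Sigma_j(A)$-systems. $\mathrm{NP}^{\mathcal{C}}$ is the class of sets accepted by a nondeterministic polynomial-time oracle Turing machine with an oracle from $\mathcal{C}$, and $\mathrm{coNP}^{\mathcal{C}}$ consists of the complements of sets in $\mathrm{NP}^{\mathcal{C}}$. *)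

(* Defs.v *)
From HB Require Import structures.
From mathcomp Require Import all_boot all_order all_algebra.
From mathcomp Require Import boolp classical_sets cardinality.

Set Implicit Arguments.
Unset Strict Implicit.
Unset Printing Implicit Defensive.

Local Open Scope classical_set_scope.
Local Open Scope card_scope.

Definition language := set (seq bool).
Definition lang_class := set language.

(* Tape symbols: [None] is the blank, [Some (inl b)] the input letter [b], and
   [Some (inr i)] one of the [m] auxiliary symbols of the machine. *)
Definition symbol (m : nat) : finType := option (bool + 'I_m)%type.

(* Head moves: [None] stays, [Some true] goes right, [Some false] goes left. *)
Definition move : finType := option bool.

(* Nondeterministic multitape oracle Turing machines. Tape [ord0] initially
   holds the input, tape [ord_max] is the query tape. States and symbols are
   taken to be initial segments of nat, so that a machine is a finite object.
   The transition relation is a finite set of pairs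
   ((state, symbols read), (new state, symbols written and head moves)). *)
Record notm := Notm {
  nstates : nat;
  nwork : nat;
  nsym : nat;
  q_start : 'I_nstates;
  q_accept : 'I_nstates;
  q_query : 'I_nstates;
  q_yes : 'I_nstates;
  q_no : 'I_nstates;
  delta : {set ('I_nstates * (nwork.+2).-tuple (symbol nsym)) *
               ('I_nstates * (nwork.+2).-tuple (symbol nsym * move)%type)}
}.

(* One-way infinite tape: contents (blank past the end of the sequence) and
   head position. *)
Definition tape (m : nat) : choiceType := (seq (symbol m) * nat)%type.

Definition blank_tape m : tape m := ([::], 0).

Definition input_tape m (x : seq bool) : tape m :=
  ([seq Some (inl b) | b <- x], 0).

Definition read m (t : tape m) : symbol m := nth None t.1 t.2.

(* A left move on the leftmost cell leaves the head in place. *)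
Definition move_head (d : move) (h : nat) : nat :=
  match d with
  | None => h
  | Some true => h.+1
  | Some false => h.-1
  end.

Definition act m (t : tape m) (a : symbol m * move) : tape m :=
  (set_nth None t.1 t.2 a.1, move_head a.2 t.2).

(* The word queried is the longest prefix of the query tape made of letters. *)
Fixpoint letters m (s : seq (symbol m)) : seq bool :=
  match s with
  | Some (inl b) :: s' => b :: letters s'
  | _ => [::]
  end.

Definition config (M : notm) : choiceType :=
  ('I_(nstates M) * ((nwork M).+2).-tuple (tape (nsym M)))%type.

Definition init_config (M : notm) (x : seq bool) : config M :=
  (q_start M,
   [tuple if i == ord0 then input_tape (nsym M) x else blank_tape (nsym M)
   | i < (nwork M).+2]).

Definition query_word (M : notm) (c : config M) : seq bool :=
  letters (tnth c.2 ord_max).1.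

Definition answer_config (M : notm) (A : language) (c : config M) : config M :=
  (if `[< A (query_word c) >] then q_yes M else q_no M,
   [tuple if i == ord_max then blank_tape (nsym M) else tnth c.2 i
   | i < (nwork M).+2]).

(* The accepting state is halting. A query takes one step and erases the query
   tape. A configuration with no successor whose state is not [q_accept] is a
   rejecting halt. *)
Definition step (M : notm) (A : language) : rel (config M) := fun c c' =>
  (c.1 != q_accept M) &&
  (if c.1 == q_query M then c' == answer_config A c
   else [exists a : ((nwork M).+2).-tuple (symbol (nsym M) * move)%type,
     (((c.1, map_tuple (@read _) c.2), (c'.1, a)) \in delta M) &&
     (c'.2 == [tuple act (tnth c.2 i) (tnth a i) | i < (nwork M).+2])]).

(* A computation path is represented by the sequence of configurations that
   follow the initial one, so its size is its number of steps. *)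
Definition comp_paths (M : notm) (A : language) (x : seq bool) :
    set (seq (config M)) :=
  [set p | path (step A) (init_config M x) p].
Arguments comp_paths : clear implicits.

Definition acc_paths (M : notm) (A : language) (x : seq bool) :
    set (seq (config M)) :=
  [set p | comp_paths M A x p /\ (last (init_config M x) p).1 = q_accept M].
Arguments acc_paths : clear implicits.

Definition lang (M : notm) (A : language) : language :=
  [set x | acc_paths M A x !=set0].

(* The time bound is a property of the machine alone: it holds for every path
   and uniformly in the oracle. *)
Definition polytime (M : notm) : Prop :=
  exists P : {poly nat}, forall (A : language) (x : seq bool) p,
    comp_paths M A x p -> size p <= P.[size x]%R.

Definition at_most_acc (n : nat) (M : notm) (A : language) : Prop :=
  forall x : seq bool, acc_paths M A x #<= `I_n.

Definition UPle (k : nat) (A : language) : lang_class :=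
  [set L | exists M, [/\ polytime M, at_most_acc k M A & L = lang M A]].

(* L[A; N_1, ..., N_j], with the convention L[A; ] = A. *)
Fixpoint lang_sys (A : language) (Ns : seq notm) : language :=
  match Ns with
  | [::] => A
  | N :: Ns' => lang N (lang_sys A Ns')
  end.

(* The indices are shifted: [tnth Ns i] is N_(i+1), whose oracle is
   L[A; N_(i+2), ..., N_j]. *)
Definition unambiguous_sys (j : nat) (A : language) (Ns : j.-tuple notm) :
    Prop :=
  forall i : 'I_j, at_most_acc 1 (tnth Ns i) (lang_sys A (drop i.+1 Ns)).

(* Meaningful for j >= 1 only. *)
Definition USigma (j : nat) (A : language) : lang_class :=
  [set L | exists Ns : j.-tuple notm,
     [/\ forall i, polytime (tnth Ns i), unambiguous_sys A Ns
       & L = lang_sys A Ns]].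

Definition NP (C : lang_class) : lang_class :=
  [set L | exists M B, [/\ polytime M, C B & L = lang M B]].

Definition coNP (C : lang_class) : lang_class := [set L | NP C (~` L)].

(* Main.v *)
(** The witness is [length_lang A], the set of all x such that A contains a word
    of length |x|, where A has at most k words of each length; guessing such a
    word places it in UP_{<=k}^A.

    A system of i unambiguous levels is insensitive to adding a word to its
    oracle: if it stays unambiguous for every oracle obtained by adding at most k
    words of length n to A, and |B| + i < k, then its answer to a given query
    differs between A + B and A + B + w for polynomially many w only.  For i = 0
    at most one w matters.  For i > 0, by induction, a given path changes its
    status for few w, because few w change the answer to one of its queries; so
    an accepting path is destroyed by few w.  If many w created an accepting path
    p_w, then for most pairs w, w' both p_w and p_w' would accept A + B + w + w',
    whence p_w = p_w' by unambiguity; a single path, rejecting at A + B, would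
    accept at A + B + w for many w, which is impossible.

    Hence an NP machine above k - 1 unambiguous levels that accepts an input of
    length n when A has no word of length n still accepts after some word of
    length n is added to A.  Stage by stage, A is built so that each such system
    is ambiguous or errs on the complement of [length_lang A]. *)

Require Import Defs.
From mathcomp Require Import all_boot all_order all_algebra.
From mathcomp Require Import boolp classical_sets cardinality.
From mathcomp Require Import functions zify.

Set Implicit Arguments.
Unset Strict Implicit.
Unset Printing Implicit Defensive.

(** * Bounds on cardinalities *)

Lemma card_le1_inj (T : Type) (E : set T) :
  (E #<= `I_1)%card -> forall p q, E p -> E q -> p = q.
Proof.
move=> /card_leP[f] p q Ep Eq.
have zero z : val (f z) = 0.
  by have := set_mem (valP (f z)); rewrite /= ltnS leqn0 => /eqP.
have : f (exist _ p (mem_set Ep)) = f (exist _ q (mem_set Eq)).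
  by apply: val_inj; rewrite !zero.
by move/(@inj _ _ _ f) => /(_ (in_setT _) (in_setT _)) [].
Qed.

Lemma card_le_map_seq (T U : choiceType) (f : T -> U) (s : seq T) k
    (E : set U) :
  size s <= k -> (forall u, E u -> exists2 t, t \in s & u = f t) ->
  (E #<= `I_k)%card.
Proof.
move=> sk Es; apply: card_le_trans (_ : `I_(size s) #<= `I_k)%card; last first.
  by rewrite card_le_II.
case: s => [|t0 s] in sk Es *.
  have -> : E = set0 by rewrite -subset0 => u /Es[].
  exact: card_ge0.
apply: card_le_trans (card_image_le (fun i => f (nth t0 (t0 :: s) i)) _).
apply: subset_card_le => u /Es[t ts ->]; exists (index t (t0 :: s)).
  by move: ts; rewrite -index_mem.
by rewrite nth_index.
Qed.

(** * Computation paths and the words they query *)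

Section Oracles.
Variables (M : notm).
Implicit Types (O : language) (c : config M) (p : seq (config M)).

Lemma eq_step O O' c c' :
  (O (query_word c) <-> O' (query_word c)) -> step O c c' = step O' c c'.
Proof.
by move=> /propext eqO; rewrite /step /answer_config eqO.
Qed.

Lemma eq_path_step O O' c p :
  {in c :: p, forall c', O (query_word c') <-> O' (query_word c')} ->
  path (step O) c p = path (step O') c p.
Proof.
elim: p c => //= d p IHp c eqO; rewrite (IHp d) ?(@eq_step O O') //.
  by apply: eqO; rewrite mem_head.
by move=> e ep; apply: eqO; rewrite inE ep orbT.
Qed.

Lemma acc_paths_transfer O O' x p :
  {in init_config M x :: p,
    forall c, O (query_word c) <-> O' (query_word c)} ->
  acc_paths M O x p -> acc_paths M O' x p.
Proof.
by move=> eqO [pO acc]; split=> //; rewrite /comp_paths /= -(eq_path_step eqO).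
Qed.

(** The head position is bounded along with the tape contents, because writing at the head pads the
    tape up to that position. *)
Definition short_query t c :=
  (size (tnth c.2 ord_max).1 <= t) && ((tnth c.2 ord_max).2 <= t).

Lemma step_short_query O t c c' :
  step O c c' -> short_query t c -> short_query t.+1 c'.
Proof.
rewrite /step /short_query => /andP[_]; case: ifP => [_ /eqP->|_].
  by rewrite tnth_mktuple eqxx.
case/existsP=> a /andP[_ /eqP->]; rewrite tnth_mktuple /= size_set_nth.
move: (tnth c.2 ord_max) => [s h] /= /andP[sz ht].
by case: (tnth a ord_max).2 => [[]|] /=; lia.
Qed.

Lemma path_short_query O t c p :
  path (step O) c p -> short_query t c ->
  {in c :: p, forall c', short_query (t + size p) c'}.
Proof.
elim: p t c => [|d p IHp] t c /=.
  by rewrite addn0 => _ sc c'; rewrite inE => /eqP->.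
case/andP=> cd pd sc c'; rewrite inE => /predU1P[->|]; last first.
  by rewrite addnS -addSn; apply: IHp => //; apply: step_short_query cd _.
by move: sc; rewrite /short_query; lia.
Qed.

Lemma size_letters m (s : seq (symbol m)) : size (letters s) <= size s.
Proof. by elim: s => //= -[[b|i]|] s IHs //=. Qed.

(** The query tape starts blank and each step lengthens it by at most one cell, so the bound does
    not involve the input. *)
Lemma size_query_word O x p :
  comp_paths M O x p ->
  {in init_config M x :: p, forall c, size (query_word c) <= size p}.
Proof.
move=> pO c cp; apply: leq_trans (size_letters _) _.
have /(_ 0)/(_ _ _ cp) := path_short_query pO.
by rewrite add0n => /(_ _)/andP[] //; rewrite /short_query tnth_mktuple.
Qed.

End Oracles.

(** * Time bounds and locality *)

Lemma poly_nat_bound (P : {poly nat}) :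
  exists c, forall n : nat, P.[n]%R <= (n + 2) ^ c.
Proof.
pose a i : nat := (P`_i)%R.
have natX (m i : nat) : (m ^+ i)%R = m ^ i.
  by elim: i => // i IHi; rewrite GRing.exprS IHi expnS.
(* With S the sum of the coefficients, P(n) is at most S (n+2)^(size P), and S < (n+2)^S since the
   base is at least 2. *)
exists (\sum_(i < size P) a i + size P) => n.
rewrite horner_coef expnD.
apply: (@leq_trans (\sum_(i < size P) a i * (n + 2) ^ size P)).
  apply: leq_sum => i _; rewrite natX; apply: leq_mul => //.
  apply: (@leq_trans ((n + 2) ^ i)).
    by case: {+}(nat_of_ord i) => // j; rewrite leq_exp2r // leq_addr.
  by rewrite leq_pexp2l ?addn2 // ltnW.
rewrite -big_distrl leq_mul2r; apply/orP; right.
by apply: ltnW; apply: ltn_expl; rewrite addn2.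
Qed.

Lemma polytime_bound M : polytime M ->
  exists c, forall O x p t, comp_paths M O x p -> size x <= t ->
    size p <= (t + 2) ^ c.
Proof.
move=> [P MP]; have [c Pc] := poly_nat_bound P.
exists c => O x p t /MP szp xt; apply: leq_trans szp _.
apply: leq_trans (Pc _) _.
by case: c {Pc} => // c; rewrite leq_exp2r // leq_add2r.
Qed.

Lemma exp_dominates c l : exists2 n, l <= n & (n + 2) ^ c < 2 ^ n.
Proof.
(* With n + 2 = 2^(2b), the left side becomes 2^(2bc), so 2bc < 2^(2b) - 2 suffices; this follows
   from (b+1)^2 <= 2^(2b). *)
pose b := 2 * c + l + 2; exists (2 ^ (2 * b) - 2).
all: have : b.+1 * b.+1 <= 2 ^ (2 * b)
  by rewrite mul2n -addnn expnD leq_mul // ltn_expl.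
  by move: (2 ^ _) => B; rewrite /b; nia.
move=> lb; rewrite subnK; last by move: lb; move: (2 ^ _) => B; rewrite /b; nia.
by rewrite -expnM ltn_exp2l //; move: lb; move: (2 ^ _) => B; rewrite /b; nia.
Qed.

(** Levels are given by splittings of the list instead of indices, which suits induction on the
    list; [Ns'] is the system serving as oracle of [N]. *)
Definition levels (Q : notm -> seq notm -> Prop) (Ns : seq notm) :=
  forall s N Ns', Ns = s ++ N :: Ns' -> Q N Ns'.

Lemma levels_cons Q N Ns : levels Q (N :: Ns) -> Q N Ns /\ levels Q Ns.
Proof.
move=> QNs; split; first exact: (QNs [::]).
by move=> s N' Ns' eqNs; apply: (QNs (N :: s)); rewrite eqNs.
Qed.

Lemma levels_tnth j (Q : notm -> seq notm -> Prop) (Ns : j.-tuple notm) :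
  (forall i : 'I_j, Q (tnth Ns i) (drop i.+1 Ns)) -> levels Q Ns.
Proof.
move=> QNs s N Ns' defNs.
have ltsj : size s < j.
  by rewrite -(size_tuple Ns) defNs size_cat /= addnS leq_addr.
have := QNs (Ordinal ltsj); rewrite (tnth_nth N) defNs /= nth_cat ltnn subnn /=.
by rewrite -cat_rcons -(size_rcons s N) drop_size_cat.
Qed.

Notation polytimes := (levels (fun N _ => polytime N)).

(** A path can only query words no longer than its running time. Whole sets of accepting paths are
    compared, so that ambiguity is local as well as acceptance. *)
Lemma lang_local M : polytime M ->
  exists r : nat -> nat, forall O O' t,
    (forall z, size z <= r t -> (O z <-> O' z)) ->
  forall x, size x <= t -> acc_paths M O x = acc_paths M O' x.
Proof.
case/polytime_bound=> c Mc; exists (fun t => (t + 2) ^ c).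
move=> O O' t eqO x xt.
have le p O1 : acc_paths M O1 x p ->
  {in init_config M x :: p, forall c, O (query_word c) <-> O' (query_word c)}.
  case=> pO _ d dp; apply: eqO; apply: leq_trans (size_query_word pO dp) _.
  exact: Mc pO xt.
rewrite predeqE => p; split=> ap; apply: (acc_paths_transfer _ (ap)).
  exact: le ap.
by move=> d dp; apply: iff_sym; apply: le ap _ dp.
Qed.

Lemma lang_sys_local Ns : polytimes Ns ->
  exists r : nat -> nat, forall A A' t,
    (forall z, size z <= r t -> (A z <-> A' z)) ->
  forall x, size x <= t -> (lang_sys A Ns x <-> lang_sys A' Ns x).
Proof.
elim: Ns => [|N Ns IHNs]; first by exists id => A A' t eqA x /eqA.
case/levels_cons=> /lang_local[r1 N_loc] /IHNs[r Ns_loc].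
exists (fun t => r (r1 t)) => A A' t eqA x xt /=.
rewrite /lang /= (N_loc _ (lang_sys A' Ns) t) // => z.
exact: Ns_loc eqA z.
Qed.

(** * Sensitivity of unambiguous systems *)

Section Sensitivity.
Variables (n : nat) (A : language).
Implicit Types (B W : {set n.-tuple bool}) (Ns : seq notm).

Definition add_words B : language :=
  [set x | A x \/ x \in map val (enum B)]%classic.

Definition flips Ns B x : {set n.-tuple bool} :=
  [set w | `[< lang_sys (add_words B) Ns x >] !=
           `[< lang_sys (add_words (w |: B)) Ns x >]].

Lemma flipsPn Ns B x w : w \notin flips Ns B x ->
  lang_sys (add_words B) Ns x <-> lang_sys (add_words (w |: B)) Ns x.
Proof. rewrite finset.inE negbK => /eqP eq_w; exact: asbool_eq_equiv eq_w. Qed.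

Definition path_flips M Ns B x p : {set n.-tuple bool} :=
  \bigcup_(c <- init_config M x :: p) flips Ns B (query_word c).

Lemma path_flipsPn M Ns B x p w : w \notin path_flips Ns B x p ->
  {in init_config M x :: p, forall c,
    lang_sys (add_words B) Ns (query_word c) <->
    lang_sys (add_words (w |: B)) Ns (query_word c)}.
Proof.
move=> wF c cp; apply: flipsPn; apply: contra wF => wF.
by rewrite /path_flips (big_rem _ cp) finset.in_setU wF.
Qed.

Lemma acc_paths_add M Ns B x p w : w \notin path_flips Ns B x p ->
  acc_paths M (lang_sys (add_words B) Ns) x p <->
  acc_paths M (lang_sys (add_words (w |: B)) Ns) x p.
Proof.
move=> /path_flipsPn eqO; split; apply: acc_paths_transfer => // c cp.
by apply: iff_sym; apply: eqO.
Qed.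

(** A union bound over the configurations. The oracle [O] only serves to bound the query words, so a
    path accepting for one set of added words can be measured against another. *)
Lemma card_path_flips M O Ns B x p D T :
  comp_paths M O x p -> size p <= T ->
  (forall y, size y <= T -> #|flips Ns B y| <= D) ->
  #|path_flips Ns B x p| <= T.+1 * D.
Proof.
move=> pO szp flD; apply: (@leq_trans ((size p).+1 * D)); last first.
  by rewrite leq_mul2r ltnS szp orbT.
have : {in init_config M x :: p, forall c, #|flips Ns B (query_word c)| <= D}.
  move=> c cp; apply: flD; apply: leq_trans szp; exact: size_query_word pO _ cp.
rewrite /path_flips -[(size p).+1]/(size (init_config M x :: p)).
elim: (_ :: p) => [|c q IHq] fD; first by rewrite big_nil cards0.
rewrite big_cons mulSn; apply: leq_trans (leq_card_setU _ _) _.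
apply: leq_add; first by apply: fD; rewrite mem_head.
by apply: IHq => d dq; apply: fD; rewrite inE dq orbT.
Qed.

End Sensitivity.

(** Double counting of the edges from [w'] to the members of [out w'] inside [W]: the in-degrees sum
    to at most e |W|, so they cannot all exceed e. *)
Lemma low_indegree (T : finType) (W : {set T}) (out : T -> {set T}) e :
  W != finset.set0 -> {in W, forall w, #|out w| <= e} ->
  exists2 w, w \in W & #|[set w' in W | w \in out w']| <= e.
Proof.
move=> /set0Pn[w0 w0W] oute; apply/exists_inP; apply: contraT.
rewrite negb_exists_in => /forall_inP big_in.
have : \sum_(w in W) e.+1 <= \sum_(w in W) #|[set w' in W | w \in out w']|.
  by apply: leq_sum => w wW; rewrite ltnNge big_in.
have -> : \sum_(w in W) #|[set w' in W | w \in out w']| =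
          \sum_(w' in W) #|out w' :&: W|.
  under eq_bigr do rewrite -sum1_card big_mkcond.
  rewrite exchange_big /= [RHS]big_mkcond; apply: eq_bigr => w' _.
  case: ifP => w'W; last first.
    by rewrite big1 // => w _; rewrite inE w'W.
  rewrite -sum1_card -big_mkcondr; apply: eq_bigl => w.
  by rewrite !inE w'W andbC.
move=> sum_le; have : #|W| * e.+1 <= #|W| * e.
  rewrite -!sum_nat_const; apply: leq_trans sum_le _.
  apply: leq_sum => w wW; apply: leq_trans (oute w wW).
  by apply: subset_leq_card; apply: finset.subsetIl.
rewrite leq_mul2l ltnn orbF cards_eq0 => /eqP W0.
by rewrite W0 finset.in_set0 in w0W.
Qed.

(** Choosing [w] of low in-degree leaves few words [w'] whose accepting paths conflict with that of
    [w]. All others share its path by unambiguity, and must flip one of its queries at [B]. *)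
Lemma card_new_acceptances k n A M Ns e (B : {set n.-tuple bool}) x :
  let O B := lang_sys (add_words A B) Ns in
  (forall B' : {set n.-tuple bool}, #|B'| <= k -> at_most_acc 1 M (O B')) ->
  #|B| + 2 <= k -> ~ lang M (O B) x ->
  (forall (B' : {set n.-tuple bool}) w p,
     #|B'| <= #|B|.+1 -> acc_paths M (O (w |: B)) x p ->
     #|path_flips A Ns B' x p| <= e) ->
  #|[set w | `[< lang M (O (w |: B)) x >]]| <= 3 * e.
Proof.
move=> O unamb Bk rejB flips_e; set W := finset _.
have /choice[P accP] (w : n.-tuple bool) :
    exists p, w \in W -> acc_paths M (O (w |: B)) x p.
  case: (boolP (w \in W)) => [|_]; last by exists [::].
  by rewrite inE => /asboolP[p]; exists p.
have [->|W0] := eqVneq W finset.set0; first by rewrite cards0.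
have cardU w (B' : {set n.-tuple bool}) : #|w |: B'| <= #|B'|.+1.
  by rewrite cardsU1; case: (w \notin B'); rewrite ?add1n.
(* An edge from [w] to [w'] means that adding [w'] to [w |: B] may destroy the path [P w]. *)
pose out w := path_flips A Ns (w |: B) x (P w).
have [|w wW] := @low_indegree _ W out e W0.
  by move=> w wW; apply: (flips_e _ w) => //; apply: accP.
set ind := finset _ => ind_e.
have out_e : #|out w| <= e by apply: (flips_e _ w) => //; apply: accP.
have fl_e : #|path_flips A Ns B x (P w)| <= e.
  by apply: (flips_e _ w) => //; apply: accP.
suff : W \subset (out w :|: ind) :|: path_flips A Ns B x (P w).
  move/subset_leq_card/leq_trans; apply.
  apply: leq_trans (leq_card_setU _ _) _.
  have : #|out w :|: ind| <= #|out w| + #|ind| by apply: leq_card_setU.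
  by move: ind_e out_e fl_e; lia.
apply/fintype.subsetP => w' w'W; rewrite !finset.in_setU orbC -implyNb.
apply/implyP.
apply: contraR; rewrite negb_or => /andP[w'out]; rewrite inE w'W /= => wout.
(* Without an edge in either direction both paths accept with [w] and [w'] added; this is where two
   spare words are required. *)
have PP : P w = P w'.
  apply: (card_le1_inj (unamb (w' |: (w |: B)) _ x)).
  - by apply: leq_trans (cardU _ _) _; have := cardU w B; move: Bk; lia.
  - by apply/(acc_paths_add w'out); apply: accP.
  - by rewrite finset.setUCA; apply/(acc_paths_add wout); apply: accP.
(* Otherwise the common path would survive the removal of [w'] and accept already at [B]. *)
apply: contraT => w'fl; case: rejB; exists (P w).
by apply/(acc_paths_add w'fl); rewrite PP; apply: accP.
Qed.

(** With S = (t+2)^c, there are at most S + 1 query words on a path, each of length at most S and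
    flipped by at most (S+2)^d words; and S + 2 <= (t+2)^(c+2). *)
Lemma time_bound_growth t c d :
  ((t + 2) ^ c).+1 * ((t + 2) ^ c + 2) ^ d <= (t + 2) ^ (c.+2 * d.+1).
Proof.
have s0 : 0 < (t + 2) ^ c by rewrite expn_gt0 addn2.
have le2 : (t + 2) ^ c + 2 <= (t + 2) ^ c.+2.
  by rewrite !expnS; move: s0; move: (_ ^ c) => S; nia.
rewrite mulnS expnD expnM; apply: leq_mul; first by move: le2; lia.
by case: d => // d; rewrite leq_exp2r.
Qed.

(** Induction on the levels. The exponent is fixed before [n], [A] and [B], since the construction
    chooses [n] large in terms of it. *)
Lemma sensitivity k Ns : polytimes Ns ->
  exists d, forall n A (B : {set n.-tuple bool}) t x,
    (forall B' : {set n.-tuple bool}, #|B'| <= k ->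
       levels (fun N Ns' => at_most_acc 1 N (lang_sys (add_words A B') Ns'))
         Ns) ->
    #|B| + size Ns < k -> size x <= t -> #|flips A Ns B x| <= (t + 2) ^ d.
Proof.
elim: Ns => [_|N Ns IHNs].
  exists 0 => n A B t x _ _ _; rewrite expn0.
  (* Without machines, only adding the queried word itself can change the answer. *)
  suff flip_x w : w \in flips A [::] B x -> val w = x.
    apply/card_le1_eqP => w w' /flip_x wx /flip_x w'x.
    by apply: val_inj; rewrite wx w'x.
  apply: contraPeq => wx; apply/negP; rewrite finset.inE negbK; apply/eqP.
  apply: asbool_equiv_eq; split=> -[Ax|/mapP[v]]; first by left.
  - rewrite mem_enum => vB ->; right.
    by rewrite map_f // mem_enum finset.in_setU vB orbT.
  - by left.
  - rewrite mem_enum finset.in_setU1 => /predU1P[->|vB] xv.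
      by rewrite xv eqxx in wx.
    by right; rewrite xv map_f // mem_enum.
case/levels_cons=> /polytime_bound[c Nc] /IHNs[d sens].
pose T t := (t + 2) ^ c.
exists (2 + c.+2 * d.+1) => n A B t x unamb /= Bk xt.
have unambN (B' : {set n.-tuple bool}) : 
  #|B'| <= k -> at_most_acc 1 N (lang_sys (add_words A B') Ns).
  by move=> /unamb/levels_cons[].
pose e := (T t).+1 * (T t + 2) ^ d.
have flips_e (B' : {set n.-tuple bool}) O p :
  #|B'| <= #|B|.+1 -> acc_paths N O x p ->
    #|path_flips A Ns B' x p| <= e.
  move=> B'B [pO _]; apply: card_path_flips (pO) (Nc _ _ _ _ pO xt) _ => y yt.
  apply: sens (yt); last first.
    (* At most one more word has been added but one level is gone, so the budget [k] still
       suffices. *)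
    by apply: leq_ltn_trans Bk; rewrite addnS -addSn leq_add2r.
  by move=> B'' /unamb/levels_cons[].
apply: (@leq_trans (3 * e)).
  have [[p accp]|rej] := pselect (lang N (lang_sys (add_words A B) Ns) x).
    apply: (@leq_trans e); last by rewrite leq_pmull.
    apply: leq_trans (flips_e _ _ _ (leqnSn _) accp).
    apply: subset_leq_card; apply/fintype.subsetP => w; apply: contraLR => wp.
    rewrite inE negbK; apply/eqP/asbool_equiv_eq; split=> _.
      by exists p; apply/(acc_paths_add wp).
    by exists p.
  have B2 : #|B| + 2 <= k.
    by rewrite addn2; apply: leq_trans Bk; rewrite ltnS addnS ltnS leq_addr.
  have newW := card_new_acceptances unambN B2 rej (fun B' w p => flips_e B' _ p).
  apply: leq_trans newW.
  apply: subset_leq_card; apply/fintype.subsetP => w; rewrite !inE /=.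
  by rewrite (asboolF rej); case: asboolP.
(* The summand 2 of the exponent absorbs the factor 3, as 3 <= 2^2 <= (t+2)^2. *)
rewrite expnD; apply: leq_mul; last exact: time_bound_growth.
rewrite -[3]/(2 ^ 2).-1; apply: leq_trans (leq_pred _) _.
by rewrite leq_exp2r // addn2.
Qed.

(** * The guessing machine *)

Lemma mktuple2 T (f : 'I_2 -> T) :
  [tuple f i | i < 2] = [tuple f ord0; f ord_max].
Proof.
apply: eq_from_tnth => -[[|[|i]] lti] //; rewrite tnth_mktuple;
  rewrite (tnth_nth (f ord0)) /=.
  by congr f; apply: val_inj.
by congr f; apply: val_inj.
Qed.

Lemma set_nth_size T (x0 : T) s i a :
  i = size s -> set_nth x0 s i a = rcons s a.
Proof. by move=> ->; rewrite set_nthE ltnn subnn cats1. Qed.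

Lemma set_nth_nth (T : eqType) (x0 y0 : T) s i :
  i < size s -> set_nth x0 s i (nth y0 s i) = s.
Proof. by move=> ltis; rewrite set_nthE ltis -drop_nth // cat_take_drop. Qed.

Definition letter (b : bool) : symbol 0 := Some (inl b).

Lemma letters_rcons u : letters (rcons (map letter u) None) = u.
Proof. by elim: u => //= b u ->. Qed.

Definition st0 : 'I_4 := Ordinal (isT : 0 < 4).
Definition st1 : 'I_4 := Ordinal (isT : 1 < 4).
Definition st2 : 'I_4 := Ordinal (isT : 2 < 4).
Definition st3 : 'I_4 := Ordinal (isT : 3 < 4).

(* State 0 copies nondeterministic bits to the query tape, one per input letter;
   state 1 queries, states 2 and 3 are the accepting and rejecting halts. *)
Definition guess_delta :
    {set ('I_4 * 2.-tuple (symbol 0)) *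
         ('I_4 * 2.-tuple (symbol 0 * move)%type)} :=
  [set t | [exists b, exists g, exists s,
              t == ((st0, [tuple letter b; s]),
                    (st0, [tuple (letter b, Some true); (letter g, Some true)]))]
        || [exists s, t == ((st0, [tuple None; s]),
                            (st1, [tuple (None, None); (None, None)]))]].

Definition guess : notm := @Notm 4 0 0 st0 st2 st1 st2 st3 guess_delta.

Definition guess_config (x u : seq bool) : config guess :=
  (st0, [tuple (map letter x, size u); (map letter u, size u)]).

(** The trailing [None] is the blank written under each head by the step that enters the query
    state. *)
Definition ask_config (x u : seq bool) : config guess :=
  (st1, [tuple (rcons (map letter x) None, size u);
               (rcons (map letter u) None, size u)]).

Definition verdict (A : language) (x u : seq bool) : config guess :=
  answer_config A (ask_config x u).

Lemma verdictE A x u : 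
  (verdict A x u).1 = if `[< A u >] then st2 else st3.
Proof.
have qw : query_word (ask_config x u) = u.
  by rewrite /query_word (tnth_nth (blank_tape 0)) /= letters_rcons.
by rewrite -{2}qw.
Qed.

Lemma guess_init x : init_config guess x = guess_config x [::].
Proof. by congr pair; rewrite mktuple2. Qed.

Section GuessSteps.
Variables (A : language) (x u : seq bool).
Hypothesis ux : size u <= size x.

Lemma guess_stepP c :
  reflect ((exists2 b, size u < size x & c = guess_config x (rcons u b)) \/
           size u = size x /\ c = ask_config x u)
          (step A (guess_config x u) c).
Proof.
have read2 : map_tuple (@read 0) (guess_config x u).2 =
    [tuple nth None (map letter x) (size u); nth None (map letter u) (size u)].
  by apply: val_inj.
apply: (iffP idP).
  rewrite /step /= => /existsP[a /andP[]]; rewrite read2 => ad /eqP c2.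
  move: ad; rewrite inE.
  case/orP=> [/existsP[b /existsP[g /existsP[s /eqP[rx _ c1 ea]]]]|].
  - left; have lt : size u < size x.
      by rewrite ltnNge; apply/negP => le; rewrite nth_default ?size_map in rx.
    exists g => //; rewrite [c]surjective_pairing c1 c2 mktuple2 ea.
    rewrite /guess_config size_rcons map_rcons; congr pair.
    apply: val_inj; rewrite /= /act /=.
    rewrite -rx set_nth_nth ?size_map //.
    by rewrite set_nth_size ?size_map.
  - case/existsP=> s /eqP[rx _ c1 ea]; right.
    have eq_size : size u = size x.
      apply/eqP; rewrite eqn_leq ux leqNgt; apply/negP => lt.
      by rewrite (nth_map false) in rx.
    split=> //; rewrite [c]surjective_pairing c1 c2 mktuple2 ea.
    congr pair; apply: val_inj; rewrite /= /act /=.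
    by rewrite !set_nth_size ?size_map.
rewrite /step /= read2; case=> [[b lt ->]|[eq_size ->]].
  apply/existsP; exists [tuple (letter (nth false x (size u)), Some true);
                               (letter b, Some true)].
  rewrite inE; apply/andP; split.
    apply/orP; left; apply/existsP; exists (nth false x (size u)).
    apply/existsP; exists b.
    apply/existsP; exists (nth None (map letter u) (size u)).
    by rewrite (nth_map false).
  apply/eqP; rewrite mktuple2; apply: val_inj; rewrite /= /act /=.
  rewrite size_rcons map_rcons -(nth_map false None) // set_nth_nth ?size_map //.
  by rewrite set_nth_size ?size_map.
apply/existsP; exists [tuple (None, None); (None, None)].
rewrite inE; apply/andP; split.
  apply/orP; right; apply/existsP; exists (nth None (map letter u) (size u)).
  by rewrite [nth _ (map _ x) _]nth_default ?size_map ?eq_size.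
apply/eqP; rewrite mktuple2; apply: val_inj; rewrite /= /act /=.
by rewrite !set_nth_size ?size_map.
Qed.

End GuessSteps.

Lemma ask_stepE A x u c : step A (ask_config x u) c = (c == verdict A x u).
Proof. by []. Qed.

Lemma verdict_halts A x u c : step A (verdict A x u) c = false.
Proof.
rewrite /step verdictE; case: asboolP => //= _.
apply/negbTE/negP => /existsP[a /andP[]]; rewrite inE => /orP[] H _; move: H.
  by do 3!case/existsP=> ?; move/eqP; case.
by case/existsP=> ? /eqP; case.
Qed.

(** An accepting path is determined by the guessed word, so counting paths reduces to counting words
    of the oracle. *)
Fixpoint guess_run A x u w : seq (config guess) :=
  match w with
  | [::] => [:: ask_config x u; verdict A x u]
  | b :: w' => guess_config x (rcons u b) :: guess_run A x (rcons u b) w'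
  end.

(** The time bound counts one step per remaining input letter, one to enter the query state and one
    for the query. *)
Lemma guess_path A x u p : size u <= size x ->
  path (step A) (guess_config x u) p ->
  size p <= size x - size u + 2 /\
  ((last (guess_config x u) p).1 = st2 ->
   exists w, [/\ size u + size w = size x, A (u ++ w) & p = guess_run A x u w]).
Proof.
elim: p u => [|c p IHp] u ux //=.
case/andP=> /(guess_stepP _ ux)[[b lt ->]|[eq_size ->]].
  move=> pp; have [|szp accp] := IHp (rcons u b) _ pp; first by rewrite size_rcons.
  rewrite size_rcons in szp; split.
    by rewrite -(subnSK lt) addSn ltnS.
  case/accp=> w []; rewrite size_rcons cat_rcons => uw Auw ->.
  by exists (b :: w); split; rewrite //= addnS -addSn.
case: p {IHp} => [_|d p] /=; first by split; first by rewrite addnS.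
rewrite ask_stepE => /andP[/eqP-> pp].
have {pp} -> : p = [::] by case: p pp => //= e p; rewrite verdict_halts.
split; first by rewrite addn2.
rewrite -[last _ _]/(verdict A x u) verdictE; case: asboolP => // Au _.
by exists [::]; rewrite cats0 addn0.
Qed.

Lemma guess_run_acc A x u w : size u + size w = size x -> A (u ++ w) ->
  path (step A) (guess_config x u) (guess_run A x u w) /\
  (last (guess_config x u) (guess_run A x u w)).1 = st2.
Proof.
elim: w u => [|b w IHw] u.
  rewrite addn0 cats0 => eq_size Au; split.
  2: by rewrite -[last _ _]/(verdict A x u) verdictE asboolT.
  rewrite /= ask_stepE eqxx !andbT; apply/guess_stepP; first by rewrite eq_size.
  by right.
rewrite -cat_rcons /= addnS -addSn -(size_rcons u b) => eq_size Auw.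
have [-> ->] := IHw _ eq_size Auw; split=> //; rewrite andbT.
have lt : size u < size x by rewrite -eq_size size_rcons leq_addr.
by apply/guess_stepP; [exact: ltnW | left; exists b].
Qed.

Lemma acc_paths_guess A x p : acc_paths guess A x p <->
  exists w, [/\ size w = size x, A w & p = guess_run A x [::] w].
Proof.
rewrite /acc_paths /comp_paths /= guess_init.
split=> [[pp accp]|[w [wx Aw ->]]].
  by have [_ /(_ accp)] := @guess_path A x [::] p (leq0n _) pp.
exact: guess_run_acc.
Qed.

Lemma polytime_guess : polytime guess.
Proof.
exists ('X + polyC 2)%R => A x p; rewrite /comp_paths /= guess_init.
case/guess_path => // szp _; apply: leq_trans szp _.
by rewrite hornerD hornerX hornerC /= subn0.
Qed.

Definition length_lang (A : language) : language :=
  [set x | exists2 w, A w & size w = size x]%classic.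

Lemma lang_guess A : lang guess A = length_lang A.
Proof.
rewrite predeqE => x; split=> [[p /acc_paths_guess[w [wx Aw _]]]|[w Aw wx]].
  by exists w.
by exists (guess_run A x [::] w); apply/acc_paths_guess; exists w.
Qed.

(** Cardinality is expressed by duplicate-free lists: such a list is finite, hence already contained
    in some stage of the construction. *)
Definition sparse k (A : language) := forall n s,
  uniq s -> {in s, forall w, A w /\ size w = n} -> size s <= k.

Lemma UPle_length_lang k A : sparse k A -> UPle k A (length_lang A).
Proof.
move=> spA; exists guess; split; [exact: polytime_guess | | by rewrite lang_guess] => x.
pose s := [seq w <- map val (enum {:(size x).-tuple bool}) | `[< A w >]].
apply: (@card_le_map_seq _ _ (guess_run A x [::]) s).
  apply: (spA (size x)).
    by rewrite filter_uniq // (map_inj_uniq val_inj) enum_uniq.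
  move=> w; rewrite mem_filter => /andP[/asboolP Aw /mapP[v _ wv]].
  by split=> //; rewrite wv size_tuple.
move=> p /acc_paths_guess[w [wx Aw ->]]; exists w => //.
rewrite mem_filter asboolT //=; apply/mapP.
by move/eqP: wx => wx; exists (Tuple wx); rewrite ?mem_enum.
Qed.

(** * Construction of the oracle *)

Definition agree l (A A' : language) := forall w, size w < l -> (A w <-> A' w).

(** Finite extension argument: requirement [s] is forced at step [s] by the part of the oracle below
    a length bound, which all later stages preserve. *)
Lemma staged_oracle k (R : nat -> language -> Prop) :
  (forall s l A, sparse k A -> (forall w, A w -> size w < l) ->
     exists l' A', [/\ l <= l', sparse k A', forall w, A' w -> size w < l',
       agree l A A' &
       forall A'', agree l' A' A'' -> R s A'']) ->
  exists2 A, sparse k A & forall s, R s A.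
Proof.
move=> extend.
pose ok (st : nat * language) :=
  sparse k st.2 /\ forall w, st.2 w -> size w < st.1.
(* The function [next] must be total; outside [ok] its value is arbitrary. *)
have /choice[next nextP] (a : nat * (nat * language)) : exists st', ok a.2 ->
    [/\ a.2.1 <= st'.1, ok st', agree a.2.1 a.2.2 st'.2 &
        forall A'', agree st'.1 st'.2 A'' -> R a.1 A''].
  case: a => s [l A] /=; have [[spA ltA]|] := pselect (ok (l, A)); last first.
    by exists (0, set0).
  by have [l' [A' [? ? ? ? ?]]] := extend s l A spA ltA; exists (l', A').
pose fix stage s :=
  if s is s'.+1 then next (s', stage s') else (0, set0 : language).
have stage_ok s : ok (stage s).
  elim: s => [|s IHs]; last by have [] := nextP (s, _) IHs.
  split=> // n [|w t] // _ /(_ w).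
  by rewrite mem_head => /(_ isT)[].
have stageP s := nextP (s, stage s) (stage_ok s).
have stage_mono s t w : s <= t -> (stage s).2 w -> (stage t).2 w.
  elim: t => [|t IHt]; first by rewrite leqn0 => /eqP->.
  rewrite leq_eqVlt => /predU1P[->//|st sw].
  have tw := IHt st sw; have [_ _ agr _] := stageP t.
  by apply/agr => //; apply: (stage_ok t).2.
have stage_le s t : s <= t -> (stage s).1 <= (stage t).1.
  elim: t => [|t IHt]; first by rewrite leqn0 => /eqP->.
  rewrite leq_eqVlt => /predU1P[->//|st]; apply: leq_trans (IHt st) _.
  by have [] := stageP t.
pose A : language := [set w | exists s, (stage s).2 w]%classic.
(* The bounds never decrease, so no word below the bound of stage [s] is added later. *)
have agreeA s : agree (stage s).1 (stage s).2 A.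
  move=> w ws; split=> [sw|[t]]; first by exists s.
  have [ts|/ltnW st] := leqP t s; first exact: stage_mono.
  elim: t st => [|t IHt]; first by rewrite leqn0 => /eqP->.
  rewrite leq_eqVlt => /predU1P[->//|st tw]; apply: (IHt st).
  have [_ _ agr _] := stageP t; apply: (proj2 (agr w _) tw).
  exact: leq_trans ws (stage_le s t st).
exists A; last first.
  by move=> s; have [_ _ _ RA] := stageP s; apply: RA; apply: (agreeA s.+1).
move=> n s us sA.
suff [t st] : exists t, {in s, forall w, (stage t).2 w}.
  apply: ((stage_ok t).1 n s us) => w ws; split; first exact: st.
  by have [] := sA w ws.
elim: s sA {us} => [|w s IHs] sA; first by exists 0.
have [|t st] := IHs; first by move=> v vs; apply: sA; rewrite inE vs orbT.
have [[t' wt'] _] := sA w (mem_head _ _).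
exists (maxn t t') => v; rewrite inE => /predU1P[->|/st].
  exact: stage_mono (leq_maxr _ _) wt'.
exact: stage_mono (leq_maxl _ _).
Qed.

(** * Enumeration of the systems *)

(** The type of the remaining data depends on the three sizes, so these data are first coded as a
    number and then paired with the sizes. *)
Lemma notm_countable : exists code : notm -> nat, injective code.
Proof.
pose states n : finType := ('I_n * 'I_n * 'I_n * 'I_n * 'I_n)%type.
pose data (n w m : nat) : finType := (states n *
  {set ('I_n * (w.+2).-tuple (symbol m)) *
       ('I_n * (w.+2).-tuple (symbol m * move)%type)})%type.
pose decode i : option notm :=
  if unpickle i is Some (n, w, m, q) then
    if (unpickle q : option (data n w m)) is Some (q0, qa, qq, qy, qn, del) then
      Some (Notm q0 qa qq qy qn del)
    else None
  else None.
pose encode M : nat :=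
  pickle (nstates M, nwork M, nsym M,
    pickle ((q_start M, q_accept M, q_query M, q_yes M, q_no M, delta M)
            : data (nstates M) (nwork M) (nsym M))).
have encodeK : pcancel encode decode.
  by case=> *; rewrite /encode /decode !pickleK.
by exists encode; apply: pcan_inj encodeK.
Qed.

Lemma systems_countable : exists code : notm * seq notm -> nat, injective code.
Proof.
have [code codeI] := notm_countable.
exists (fun S => pickle (code S.1, map code S.2)) => -[M Ns] [M' Ns'].
by move/(pcan_inj pickleK) => [/codeI-> /(inj_map codeI)->].
Qed.

(** * Meeting a single requirement *)

Definition separated k (M : notm) (Ns : k.-1.-tuple notm) (A : language) :=
  polytime M -> (forall i, polytime (tnth Ns i)) -> unambiguous_sys A Ns ->
  lang M (lang_sys A Ns) <> (~` length_lang A)%classic.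

Lemma levels_drop Q Ns i : levels Q Ns -> levels Q (drop i Ns).
Proof.
move=> QNs s N Ns' eqNs; apply: (QNs (take i Ns ++ s)).
by rewrite -catA -eqNs cat_take_drop.
Qed.

(** Failure of unambiguity and a wrong answer are each witnessed at a single input, hence by a
    bounded part of the oracle. *)
Lemma separated_open k M (Ns : k.-1.-tuple notm) A : separated M Ns A ->
  exists r, forall A', agree r A A' -> separated M Ns A'.
Proof.
move=> sepA; have [MP|nMP] := pselect (polytime M).
  2: by exists 0 => A' _ /nMP.
have [NP|nNP] := pselect (forall i, polytime (tnth Ns i)).
  2: by exists 0 => A' _ _ /nNP.
have NsP : polytimes Ns := levels_tnth (Q := fun N _ => polytime N) NP.
have [unA|/existsNP[i /existsNP[y ambA]]] := pselect (unambiguous_sys A Ns).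
2: {
  have [r N_loc] := lang_local (NP i).
  have [r' Ns_loc] := lang_sys_local (levels_drop (i := i.+1) NsP).
  exists (r' (r (size y))).+1 => A' agr _ _ /(_ i y) unA'.
  case: ambA; move: unA'.
  rewrite -(N_loc (lang_sys A (drop i.+1 Ns)) _ (size y)) // => z.
  by apply: Ns_loc => v; apply: agr. }
have [x diffA] : exists x, ~ (lang M (lang_sys A Ns) x <-> ~ length_lang A x).
  by apply/existsNP => eqA; apply: (sepA MP NP unA); rewrite predeqE.
have [r M_loc] := lang_local MP; have [r' Ns_loc] := lang_sys_local NsP.
(* The first bound fixes the answer of the system at [x], the second the words of length |x| that
   decide [length_lang]. *)
exists (maxn (r' (r (size x))) (size x)).+1 => A' agr _ _ _ eqA'; apply: diffA.
have -> : lang M (lang_sys A Ns) x = lang M (lang_sys A' Ns) x.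
  rewrite /lang /= (M_loc _ (lang_sys A' Ns) (size x)) // => z.
  by apply: Ns_loc => v vr; apply: agr; rewrite ltnS leq_max vr.
have agr_x w : size w = size x -> (A w <-> A' w).
  by move=> wx; apply: agr; rewrite ltnS wx leq_maxr.
rewrite eqA'; split=> notL [w Aw wx]; apply: notL; exists w => //.
  exact: (proj1 (agr_x w wx)).
exact: (proj2 (agr_x w wx)).
Qed.

Lemma sparse_add_words k n A (B : {set n.-tuple bool}) : sparse k A ->
  (forall w, A w -> size w < n) -> #|B| <= k -> sparse k (add_words A B).
Proof.
move=> spA ltA Bk m s us sAB; have [mn|nm] := ltnP m n.
  apply: (spA m s us) => w ws; have [[Aw|/mapP[v _ wv]] wm] := sAB w ws => //.
  by move: mn; rewrite -wm wv size_tuple ltnn.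
apply: leq_trans Bk; rewrite cardE -(size_map val).
apply: uniq_leq_size => // w /sAB[[/ltA wn|//] wm].
by move: nm; rewrite -wm leqNgt wn.
Qed.

(** If no choice of [B] worked, the system would be unambiguous and correct for all of them.
    Unambiguity gives low sensitivity, so some word can be added without destroying an accepting
    path, contradicting correctness. *)
Lemma separating_words k M (Ns : k.-1.-tuple notm) A l : 1 < k ->
  (forall w, A w -> size w < l) ->
  exists n (B : {set n.-tuple bool}),
    [/\ l <= n, #|B| <= k & separated M Ns (add_words A B)].
Proof.
move=> k2 ltA.
have [MP|nMP] := pselect (polytime M); last first.
  by exists l, finset.set0; rewrite cards0; split=> // /nMP.
have [NP|nNP] := pselect (forall i, polytime (tnth Ns i)); last first.
  by exists l, finset.set0; rewrite cards0; split=> // _ /nNP.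
have [c Mc] := polytime_bound MP.
have [d sens] := sensitivity k (levels_tnth (Q := fun N _ => polytime N) NP).
(* This [n] makes the words that can disturb an accepting path fewer than the 2^n words of length
   n. *)
have [n ln big_n] := exp_dominates (c.+2 * d.+1) l; exists n.
apply: contrapT => /forallNP unsep.
have {}unsep (B : {set n.-tuple bool}) : #|B| <= k ->
  unambiguous_sys (add_words A B) Ns /\
  lang M (lang_sys (add_words A B) Ns) = (~` length_lang (add_words A B))%classic.
  move=> Bk; apply: contrapT => sepB; apply: (unsep B); split=> // _ _ unB eqB.
  by apply: sepB.
pose x := nseq n false; pose B0 : {set n.-tuple bool} := finset.set0.
have [|_ eq0] := unsep B0; first by rewrite cards0.
have [p accp] : lang M (lang_sys (add_words A B0) Ns) x.
  rewrite eq0 /= => -[w [/ltA wl|]]; last by rewrite /B0 enum_set0.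
  by rewrite size_nseq => wn; move: wl; rewrite wn ltnNge ln.
have : #|path_flips A Ns B0 x p| < #|{: n.-tuple bool}|.
  rewrite card_tuple card_bool; apply: leq_ltn_trans big_n.
  apply: leq_trans (time_bound_growth n c d) => //.
  have xn : size x <= n by rewrite size_nseq.
  apply: (card_path_flips accp.1 (Mc _ _ _ _ accp.1 xn)).
  move=> y yn; apply: (sens n) yn; last first.
    (* The k - 1 levels fit the budget exactly because no word has been added yet. *)
    by rewrite /B0 cards0 size_tuple add0n prednK // ltnW.
  by move=> B Bk; apply: levels_tnth; have [] := unsep B Bk.
rewrite ltnNge -cardsT => few.
have [w wp] : exists w, w \notin path_flips A Ns B0 x p.
  apply: contrapT => /forallNP allp; case/negP: few.
  apply: subset_leq_card; apply/fintype.subsetP => w _.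
  by apply/negPn/negP; apply: allp.
have [|_] := unsep (w |: B0).
  by rewrite /B0 finset.setU0 cards1 ltnW.
rewrite predeqE => /(_ x)[+ _]; apply.
  by exists p; apply/(acc_paths_add wp).
exists (val w); last by rewrite size_tuple size_nseq.
by right; rewrite map_f // mem_enum finset.setU11.
Qed.

Theorem theorem4p4 (k : nat) (hk : (2 <= k)%N) :
  exists A : language, ~ (UPle k A `<=` coNP (USigma k.-1 A))%classic.
Proof.
have [code codeI] := systems_countable.
have [s l A spA ltA|A spA sepA] := @staged_oracle k (fun s A =>
  forall M (Ns : k.-1.-tuple notm), code (M, tval Ns) = s -> separated M Ns A).
  have [[M [Ns codes]]|none] :=
    pselect (exists M (Ns : k.-1.-tuple notm), code (M, tval Ns) = s); last first.
    by exists l, A; split=> // A' _ M Ns cs; case: none; exists M, Ns.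
  have [n [B [ln Bk sepB]]] := @separating_words k M Ns A l hk ltA.
  have [r sep_r] := separated_open sepB.
  have ltn w : A w -> size w < n by move/ltA/leq_trans; apply.
  (* The bound [r] protects the separation; [n.+1] exceeds the length of every word present so
     far. *)
  exists (maxn r n.+1), (add_words A B); split.
  - by rewrite leq_max (leqW ln) orbT.
  - exact: sparse_add_words.
  - move=> w [/ltn wn|/mapP[v _ ->]].
      by rewrite leq_max ltnS (ltnW wn) orbT.
    by rewrite size_tuple leq_max leqnn orbT.
  - move=> w wl; split=> [Aw|[//|/mapP[v _ wv]]]; first by left.
    by move: wl; rewrite wv size_tuple ltnNge ln.
  - move=> A' agr M' Ns' cs; move: codes; rewrite -cs.
    case/codeI=> eqM /val_inj eqNs.
    rewrite -eqM -eqNs; apply: sep_r => w wr; apply: agr.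
    by rewrite leq_max wr.
exists A => /(_ (length_lang A) (UPle_length_lang spA)).
case=> M [B [MP [Ns [NsP unNs ->]] eqM]].
exact: (sepA (code (M, tval Ns)) M Ns (erefl _) MP NsP unNs) (esym eqM).
Qed.
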